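(* Let $r,d,m,p$ be positive integers. Then there exists $c>0$ such that the following holds. Let $H$ be the complete $r$-uniform hypergraph on $N$ vertices, whose edges are colored with $p$ colors (every edge receiving at least one, possibly more than one, color) such that each color class is semi-algebraic of complexity $(d,1,m)$. Then $H$ contains a monochromatic clique of size at least $(\log N)^{c}$.
   Context: An $r$-uniform hypergraph $G$ is semi-algebraic of complexity $(d,D,m)$ if there is an enumeration $v_1,\dots,v_N$ of its vertices, an assignment $v_i\mapsto p_i\in\mathbb{R}^d$ for $i\in\{1,\dots,N\}$, $m$ polynomials $f_1,\dots,f_m:(\mathbb{R}^d)^r\to\mathbb{R}$ of (total) degree at most $D$, and a function $\Phi:\{+,-,0\}^m\to\{\text{True},\text{False}\}$ such that for all $1\le i_1<\dots<i_r\le N$, the set $\{v_{i_1},\dots,v_{i_r}\}$ is an edge of $G$ if and only if $\Phi(\operatorname{sign}(f_1(p_{i_1},\dots,p_{i_r})),\dots,\operatorname{sign}(f_m(p_{i_1},\dots,p_{i_r})))=\text{True}$, where $\operatorname{sign}(x)\in\{+,-,0\}$ is the sign of $x$. The color class of a color is the $r$-uniform hypergraph on the whole vertex set whose edges are the $r$-element sets receiving that color. A monochromatic clique is a set $C$ of vertices for which there is a color $\kappa$ such that every $r$-element subset of $C$ has $\kappa$ among its colors.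
   Formalization: The case r = 1 with 3 ≤ N ≤ p is excluded, because there N vertices with pairwise distinct colors have only monochromatic cliques of size at most 1, while (log N)^c > 1 for every c > 0; log is the natural logarithm. *)

(* Defs.v *)
From HB Require Import structures.
From mathcomp Require Import all_boot all_order all_algebra.
From mathcomp Require Import reals.
From mathcomp Require Import mpoly.

Set Implicit Arguments.
Unset Strict Implicit.
Unset Printing Implicit Defensive.

Import Order.TTheory GRing.Theory Num.Theory.
Local Open Scope ring_scope.

Inductive sign := Pos | Neg | Zero.

Definition sign_of (R : realType) (x : R) : sign :=
  if 0 < x then Pos else if x < 0 then Neg else Zero.

(* The r points of R^d are the rows of M; mxvec lists the coordinates of M, *)
(* so that a polynomial on (R^d)^r is a polynomial in r * d variables.      *)
Definition eval_rows (R : realType) (r d : nat)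
    (f : {mpoly R[r * d]}) (M : 'M[R]_(r, d)) : R :=
  f.@[mxvec M 0].

(* msize is the total degree plus one, and 0 for the zero polynomial. *)
Definition semialgebraic (R : realType) (r d D m : nat)
    (V : finType) (E : {set {set V}}) : Prop :=
  exists (v : 'I_#|V| -> V) (pt : 'I_#|V| -> 'rV[R]_d)
         (f : 'I_m -> {mpoly R[r * d]})
         (Phi : {ffun 'I_m -> sign} -> bool),
    [/\ bijective v,
        forall l : 'I_m, (msize (f l) <= D.+1)%N &
        forall i : 'I_r -> 'I_#|V|,
          (forall a b : 'I_r, (a < b)%N -> (i a < i b)%N) ->
          ([set v (i a) | a : 'I_r] \in E) =
          Phi [ffun l => sign_of (eval_rows (f l) (\matrix_a pt (i a)))]].

Section Colorings.
Variables (r p : nat) (V : finType).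

(* col e is the set of all colors received by the edge e. *)
Variable col : {set V} -> {set 'I_p}.

Definition covers_edges : Prop :=
  forall e : {set V}, #|e| = r -> col e != set0.

(* Only r-sets count, so the values of col off r-sets play no role. *)
Definition color_class (k : 'I_p) : {set {set V}} :=
  [set e : {set V} | (#|e| == r) && (k \in col e)].

Definition monochromatic_clique (C : {set V}) : Prop :=
  exists k : 'I_p,
    forall e : {set V}, e \subset C -> #|e| = r -> k \in col e.

End Colorings.

(* Main.v *)
(* A polynomial of degree 1 on r points is a constant plus a sum
   f_1(x_1) + ... + f_r(x_r), so a coloring is described by boundedly many real
   functions on the vertices. It suffices to find a long sequence of vertices on
   which the sign of each such sum is the same for all increasing r-tuples.

   One first makes every function rapidly convergent: |f(y) - L| is at most
   |f(x) - L| / K for all x before y in the sequence, or for all y before x.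
   If some function admits such a sequence of length t = 2^(n^C), pass to it and
   treat the remaining functions by induction. Otherwise every set S contains,
   after a loss of only a factor polynomial in t, a point x and a subset S' which
   is small compared with its distance to x, for all functions at once; iterating
   n times uses up only t^O(n) vertices. Hence 2^(poly n) vertices suffice.

   Then comparisons between the numbers |f_a(x) - L_a| and |f_b(y) - L_b| are
   relations that are transitive or have transitive complement, and a Dilworth
   type argument makes them constant, at a polynomial cost. As the deviations are
   rapidly monotone, whichever of two terms is larger is then larger by a big
   factor, so one term dominates the sum and fixes its sign. *)

Require Import Defs.
From mathcomp Require Import all_boot all_order all_algebra.
From mathcomp Require Import reals exp.
From mathcomp Require Import boolp sequences mpoly zify ring lra.

Set Implicit Arguments.
Unset Strict Implicit.
Unset Printing Implicit Defensive.

Import Order.TTheory GRing.Theory Num.Theory.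
Local Open Scope ring_scope.

(** * Subsequences on which a relation is constant *)

(** [g x] counts the elements after [x] on a longest chain starting at [x], as in Mirsky's theorem;
    passing to a later related element lowers it. *)
Lemma chain_labels (T : eqType) (P : rel T) (s : seq T) :
  uniq s ->
  (forall x y z, subseq [:: x; y; z] s -> P x y -> P y z -> P x z) ->
  exists g : T -> nat,
    (forall x, x \in s -> exists c,
       [/\ subseq (x :: c) s, pairwise P (x :: c) & size c = g x]) /\
    pairwise (fun x y => P x y ==> (g y < g x)%N) s.
Proof.
elim: s => [|x s IHs] /=; first by move=> _ _; exists (fun=> 0%N).
case/andP=> xs us Ptr.
have{IHs} [|g [gP gs]] := IHs us.
  move=> a b c abc; apply: Ptr.
  exact: subseq_trans abc (subseq_cons _ _).
pose h := \max_(y <- s | P x y) (g y).+1.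
exists (fun z => if z == x then h else g z); split; last first.
  apply/andP; split.
    apply/allP => y ys; rewrite eqxx; apply/implyP => Pxy.
    rewrite (negPf (memPn xs _ ys)).
    by rewrite /h (big_rem y) //= Pxy leq_max leqnn.
  have : all (mem s) s by apply/allP.
  move/(@sub_in_pairwise _ (mem s) (fun x y => P x y ==> (g y < g x)%N)).
  apply; last exact: gs.
  by move=> a b aS bS /=; rewrite (negPf (memPn xs _ aS)) (negPf (memPn xs _ bS)).
move=> z; rewrite inE => /predU1P[->|zs]; last first.
  have [c [c1 c2 c3]] := gP _ zs.
  exists c; split => //.
    exact: subseq_trans c1 (subseq_cons _ _).
  by rewrite (negPf (memPn xs _ zs)).
rewrite eqxx.
have [h0|h0] := posnP h.
  by exists [::]; split; rewrite ?h0 //= sub0seq.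
have [y ys [Pxy hy]] : exists2 y, y \in s & P x y /\ h = (g y).+1.
  have : (h == 0%N) || has (fun y => P x y && (h == (g y).+1)) s.
    rewrite {h0}/h; elim: s {us xs gs gP Ptr} => [|y s IHs]; first by rewrite big_nil.
    rewrite big_cons /=; case: (P x y) => //=.
    set M := \max_(_ <- _ | _) _ in IHs *.
    case: (leqP (g y).+1 M) => gM.
      by case/orP: IHs => ->; rewrite ?orbT.
    by rewrite eqxx.
  rewrite eqn0Ngt h0 /= => /hasP[y ys /andP[Pxy /eqP hy]].
  by exists y.
have [c [c1 c2 c3]] := gP _ ys.
exists (y :: c); split; last by rewrite hy /= c3.
  by [].
rewrite c2 andbT /= Pxy /=.
apply/allP => w wc; apply: (Ptr x y w) => //.
  rewrite /= eqxx.
  by apply: subseq_trans c1; rewrite /= eqxx sub1seq.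
by move: c2 => /= /andP[/allP/(_ _ wc)].
Qed.

Lemma subseq_of_size (T : eqType) (s : seq T) n :
  (n <= size s)%N -> exists2 s', subseq s' s & size s' = n.
Proof. by move=> ns; exists (take n s); rewrite ?take_subseq ?size_takel. Qed.

(** A label of at least [n - 1] gives a chain of [n] elements. Otherwise fewer than [n] labels
    occur, so [n] elements share one, and none of these is related to a later one. *)
Lemma pairwise_of_trans (T : eqType) (P : rel T) (s : seq T) (n : nat) :
  uniq s -> (n * n <= size s)%N ->
  (forall x y z, subseq [:: x; y; z] s -> P x y -> P y z -> P x z) ->
  exists s', [/\ subseq s' s, size s' = n &
     pairwise P s' \/ pairwise (fun x y => ~~ P x y) s'].
Proof.
move=> us ns Ptr; have [->|n0] := posnP n.
  by exists [::]; split; rewrite ?sub0seq //; left.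
have [g [gP gs]] := chain_labels us Ptr.
have [/hasP[x xs gx]|/hasPn gn] := boolP (has (fun x => n <= (g x).+1)%N s).
  have [c [c1 c2 c3]] := gP _ xs.
  have [|s' s'c s'n] := @subseq_of_size _ (x :: c) n; first by rewrite /= c3.
  exists s'; split => //; first exact: subseq_trans s'c c1.
  by left; apply: subseq_pairwise c2.
have [/existsP[i /subseq_of_size[s' s'f s'n]]|/existsPn ni] :=
    boolP [exists i : 'I_n, (n <= size [seq x <- s | g x == i])%N].
  exists s'; split => //; first exact: subseq_trans s'f (filter_subseq _ _).
  right; apply: subseq_pairwise s'f _.
  have := pairwise_filter (fun x => g x == i) gs.
  set s1 := filter _ s => gs1.
  have : all (fun x => g x == i) s1 by apply: filter_all.
  move/sub_in_pairwise; apply; last exact: gs1.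
  move=> x y /eqP gx /eqP gy /=; rewrite gx gy ltnn implybF //.
have : (\sum_(i < n) size [seq x <- s | g x == i] = size s)%N.
  transitivity (\sum_(i < n) \sum_(x <- s | g x == i) 1)%N.
    by apply: eq_bigr => i _; rewrite size_filter -sum1_count.
  rewrite (exchange_big_dep predT) //= -(sum1_size s).
  rewrite big_seq [RHS]big_seq; apply: eq_bigr => x xs.
  have gxn : (g x < n)%N by have := gn _ xs; rewrite -ltnNge => /ltnW.
  by rewrite (big_pred1 (Ordinal gxn)).
move=> e; move: ns; rewrite -e.
have : (\sum_(i < n) size [seq x <- s | g x == i] <= \sum_(i < n) n.-1)%N.
  by apply: leq_sum => i _; have := ni i; rewrite -ltnNge; lia.
rewrite sum_nat_const card_ord; nia.
Qed.

(** * Simultaneous rapid convergence *)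

Section Separation.
Variables (R : realFieldType) (V : finType).
Implicit Types (f : V -> R) (A S : {set V}).

Definition drops (K L : R) f : rel V :=
  fun x y => K * `|f y - L| <= `|f x - L|.

(** The cluster is [A]: its spread is small relative to its distance from every point of [S]. *)
Definition far (B : R) f A S : Prop :=
  forall x y z, x \in S -> y \in A -> z \in A ->
  B * `|f y - f z| <= `|f x - f y|.

(** The limit is a value of [f] on [S] itself, so a comb found in a subset can be prolonged in [S]
    with the same limit. *)
Definition comb (K : R) f S (t : nat) : Prop :=
  exists z c, [/\ z \in S, {subset c <= S}, uniq c, size c = t &
    pairwise (drops K (f z) f) c].

Lemma card_split (S : {set V}) (P : pred V) :
  (#|[set x in S | P x]| + #|[set x in S | ~~ P x]| = #|S|)%N.
Proof.
rewrite -(cardsID [set x | P x] S); congr (_ + _)%N; apply: eq_card => x.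
  by rewrite !inE andbC.
by rewrite !inE andbC.
Qed.

Lemma sep_subset (S : {set V}) (P : pred V) : [set x in S | P x] \subset S.
Proof. by rewrite setIdE subsetIl. Qed.

(** Bisect the range [h] times, always keeping the half that holds more points. *)
Lemma concentrate f (h : nat) (l D : R) S :
  (forall x, x \in S -> l <= f x <= l + D) ->
  exists S1 : {set V}, [/\ S1 \subset S, (#|S| <= 2 ^ h * #|S1|)%N &
    forall x y, x \in S1 -> y \in S1 -> 2 ^+ h * `|f x - f y| <= D].
Proof.
elim: h l D S => [|h IHh] l D S Sl.
  exists S; split; rewrite ?expn0 ?mul1n // => x y /Sl + /Sl.
  move=> /andP[x1 x2] /andP[y1 y2].
  by rewrite mul1r ler_norml; apply/andP; split; lra.
have bisect (S0 : {set V}) l0 : S0 \subset S -> (#|S| <= 2 * #|S0|)%N ->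
    (forall x, x \in S0 -> l0 <= f x <= l0 + D / 2) ->
    exists S1 : {set V}, [/\ S1 \subset S, (#|S| <= 2 ^ h.+1 * #|S1|)%N &
    forall x y, x \in S1 -> y \in S1 -> 2 ^+ h.+1 * `|f x - f y| <= D].
  move=> S0S c0 /IHh[S1 [S1S0 c1 d1]]; exists S1; split.
  - exact: subset_trans S0S.
  - by rewrite expnS; lia.
  - by move=> x y xS yS; have := d1 _ _ xS yS; rewrite exprS -mulrA; lra.
have := card_split S (fun x => f x <= l + D / 2).
set S1 := [set _ in _ | _]; set S2 := [set _ in _ | ~~ _] => e.
have [le21|le12] := leqP #|S2| #|S1|.
  apply: (bisect S1 l); [exact: sep_subset|lia|].
  by move=> x; rewrite !inE => /andP[/Sl/andP[-> _] ->].
apply: (bisect S2 (l + D / 2)); [exact: sep_subset|lia|].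
move=> x; rewrite !inE -ltNge => /andP[/Sl/andP[_ x2] x3].
by apply/andP; split; lra.
Qed.

(* Otherwise the points far from a dense cluster are few; discarding them
   shrinks the range of [f] to a small fraction of itself, and one of the two
   extreme points can be put in front of a comb found among the survivors. *)
Lemma comb_or_far (K B : R) (h k : nat) f A :
  0 <= K -> 0 <= B -> 2 * K * (2 * B + 1) <= 2 ^+ h ->
  2 * (2 * B + 1) <= 2 ^+ h -> (0 < k)%N ->
  (forall A1 A2, A1 \subset A -> A2 \subset A -> (k <= #|A1|)%N ->
     (k <= #|A2|)%N -> far B f A1 A2 -> far B f A2 A1 -> False) ->
  forall (t : nat) S, S \subset A -> (2 ^ h * k * t.+1 <= #|S|)%N ->
  comb K f S t.
Proof.
move=> K0 B0 hK hB k0 noFar; elim=> [|t IHt] S SA cS.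
  have [z zS] : exists z, z \in S.
    by apply/set0Pn; rewrite -card_gt0; have := expn_gt0 2 h; nia.
  by exists z, [::].
have h0 : (0 < 2 ^ h)%N by rewrite expn_gt0.
have [z0 z0S] : exists z, z \in S.
  by apply/set0Pn; rewrite -card_gt0; nia.
case: (@arg_minP _ _ _ z0 (mem S) f z0S) => xl xlS /= minl.
case: (@arg_maxP _ _ _ z0 (mem S) f z0S) => xh xhS /= maxh.
set D := f xh - f xl.
have D0 : 0 <= D by rewrite subr_ge0; exact: minl.
have [|P [PS cP dP]] := @concentrate f h (f xl) D S.
  by move=> x xS; rewrite minl //= addrC subrK maxh.
pose d := D / 2 ^+ h.
have p0 : 0 < 2 ^+ h :> R by rewrite exprn_gt0.
have Dd : D = 2 ^+ h * d by rewrite mulrC divfK ?gt_eqF.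
have d0 : 0 <= d by rewrite divr_ge0 // ltW.
have {}dP x y : x \in P -> y \in P -> `|f x - f y| <= d.
  by move=> xP yP; rewrite -(ler_pM2l p0) -Dd dP.
have kP : (k <= #|P|)%N.
  by rewrite -(leq_pmul2l h0); apply: leq_trans cP; apply: leq_trans cS; rewrite leq_pmulr.
pose q x := [forall y in P, B * d <= `|f x - f y|].
have := card_split S q; set Q := [set _ in _ | _].
set S' := [set _ in _ | ~~ _] => eS.
(* Otherwise [Q] would contain a large cluster [P2] of spread at most [d], at distance at least
   [B * d] from [P], against [noFar]. *)
have Qk : (#|Q| < 2 ^ h * k)%N.
  rewrite ltnNge; apply/negP => cQ.
  have [|P2 [P2Q cP2 dP2]] := @concentrate f h (f xl) D Q.
    move=> x; rewrite inE => /andP[xS _].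
    by rewrite minl //= addrC subrK maxh.
  have {}dP2 x y : x \in P2 -> y \in P2 -> `|f x - f y| <= d.
    by move=> xP yP; rewrite -(ler_pM2l p0) -Dd dP2.
  have qP x y : x \in P2 -> y \in P -> B * d <= `|f x - f y|.
    move=> /(subsetP P2Q); rewrite inE => /andP[_ /forall_inP]; exact.
  apply: (noFar P P2) => //.
  - exact: subset_trans SA.
  - exact: (subset_trans P2Q (subset_trans (sep_subset _ _) SA)).
  - by rewrite -(leq_pmul2l h0); apply: leq_trans cQ cP2.
  - move=> x y z xP yP zP; apply: le_trans (qP _ _ xP yP).
    by apply: ler_wpM2l => //; apply: dP.
  - move=> x y z xP yP zP; rewrite [leRHS]distrC.
    apply: le_trans (qP _ _ yP xP).
    by apply: ler_wpM2l => //; apply: dP2.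
have S'S : S' \subset S by apply: sep_subset.
have [|z [c [zS' cS' uc sc pc]]] := IHt S' (subset_trans S'S SA).
  rewrite -(leq_add2l (2 ^ h * k)) -mulnS; apply: leq_trans cS _.
  by rewrite -eS leq_add2r ltnW.
have near x y : x \in S' -> y \in S' -> `|f x - f y| < (2 * B + 1) * d.
  rewrite !inE => /andP[xS /forall_inPn[x1 x1P x1f]].
  move=> /andP[yS /forall_inPn[y1 y1P y1f]].
  move: x1f y1f; rewrite -!ltNge => x1f y1f.
  have := dP _ _ x1P y1P.
  have := ler_distD (f x1) (f x) (f y).
  have := ler_distD (f y1) (f x1) (f y).
  rewrite (distrC (f y1)); lra.
(* The extreme point farther from [z] is at distance at least [D / 2]. Then [hB] keeps it out of the
   comb and [hK] provides the ratio [K]. *)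
have [x xS xz] : exists2 x, x \in S & D <= 2 * `|f x - f z|.
  have zS := subsetP S'S _ zS'.
  have [le|/ltW le] := leP (`|f xl - f z|) (`|f xh - f z|).
    exists xh => //; have := ler_distD (f z) (f xh) (f xl).
    by rewrite (distrC (f z)) ger0_norm // -/D; lra.
  exists xl => //; have := ler_distD (f z) (f xh) (f xl).
  by rewrite (distrC (f z)) ger0_norm // -/D; lra.
exists z, (x :: c); split.
- exact: (subsetP S'S).
- by move=> w; rewrite inE => /predU1P[->//|/cS'/(subsetP S'S)].
- rewrite /= uc andbT; apply/negP => /cS' xS'.
  have := near _ _ xS' zS'; have := ler_wpM2r d0 hB; lra.
- by rewrite /= sc.
- rewrite /= pc andbT; apply/allP => y /cS' yS'; rewrite /drops.
  have := ler_wpM2l K0 (ltW (near _ _ yS' zS')).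
  have := ler_wpM2r d0 hK; lra.
Qed.

Lemma far_sub (B : R) f A A' S S' : A' \subset A -> S' \subset S ->
  far B f A S -> far B f A' S'.
Proof.
move=> /subsetP AA /subsetP SS fAS x y z xS yA zA.
by apply: fAS; [apply: SS|apply: AA|apply: AA].
Qed.

Lemma comb_sub (K : R) f S S' t : S' \subset S -> comb K f S' t -> comb K f S t.
Proof.
move=> /subsetP S'S [z [c [zS cS uc sc pc]]].
by exists z, c; split => //; [apply: S'S | move=> x /cS /S'S].
Qed.

(* Two mutually far clusters exist, and no point is close to both of them. *)
Lemma far_or_comb (K : R) (h k t : nat) f A A' :
  1 <= K -> 2 * K * (4 * K + 1) <= 2 ^+ h -> (0 < k)%N ->
  (2 ^ h * t.+1 * k <= #|A|)%N -> ~ comb K f A t ->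
  exists A1 A2, [/\ A1 \subset A, A2 \subset A', (k <= #|A1|)%N,
    (#|A'| <= 2 * #|A2|)%N & far K f A1 A2].
Proof.
move=> K1 hK k0 cA ncomb.
have [[A1 [A2 [[A1A A2A c1 c2] f12 f21]]]|nf] := pselect (exists A1 A2,
    [/\ [/\ A1 \subset A, A2 \subset A, (k <= #|A1|)%N & (k <= #|A2|)%N],
     far (2 * K) f A1 A2 & far (2 * K) f A2 A1]); last first.
  case: ncomb; apply: (@comb_or_far K (2 * K) h k f A); rewrite ?subxx //.
  - lra.
  - lra.
  - by rewrite [2 * (2 * K)]mulrA -natrM.
  - apply: le_trans hK; rewrite [2 * (2 * K)]mulrA -natrM.
    by rewrite ler_pM2r; lra.
  - move=> B1 B2 b1 b2 b3 b4 b5 b6; apply: nf; exists B1, B2; split => //.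
  - by rewrite mulnAC.
have pos (S : {set V}) : (k <= #|S|)%N -> exists x, x \in S.
  by move=> kS; apply/set0Pn; rewrite -card_gt0; apply: leq_trans kS.
pose q x := `[< far K f A1 [set x] >].
have := card_split A' q; set Q := [set _ in _ | _].
set Q' := [set _ in _ | ~~ _] => e.
have [leQ|ltQ] := leqP #|Q'| #|Q|.
  exists A1, Q; split => //; [exact: sep_subset|lia|].
  move=> x y z; rewrite inE => /andP[_ /asboolP fx].
  by apply: fx; rewrite inE.
exists A2, Q'; split => //; [exact: sep_subset|lia|].
move=> x w w'; rewrite inE => /andP[_ /asboolPn fx] wA wA'.
rewrite leNgt; apply/negP => xw; apply: fx => x' y y'.
rewrite inE => /eqP-> yA yA'; rewrite leNgt; apply/negP => xy.
(* The triangle inequality through [x] loses a factor 2, hence the ratio [2 * K] between the two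
   clusters. *)
have := f12 _ _ _ wA yA yA'; have := f21 _ _ _ yA wA wA'.
have := ler_distD (f x) (f y) (f w).
rewrite (distrC (f y) (f x)) (distrC (f w) (f y)); lra.
Qed.

(** The functions are treated one at a time; each costs a factor [2 ^ h * t.+1] in [A] and a factor
    2 in [A']. *)
Lemma far_or_comb_all (I : eqType) (F : I -> V -> R) (K : R) (h t : nat)
    (js : seq I) (k : nat) A A' :
  1 <= K -> 2 * K * (4 * K + 1) <= 2 ^+ h -> (0 < k)%N ->
  ((2 ^ h * t.+1) ^ size js * k <= #|A|)%N ->
  (forall j, j \in js -> ~ comb K (F j) A t) ->
  exists A1 A2, [/\ A1 \subset A, A2 \subset A', (k <= #|A1|)%N,
    (#|A'| <= 2 ^ size js * #|A2|)%N &
    forall j, j \in js -> far K (F j) A1 A2].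
Proof.
move=> K1 hK k0; elim: js A A' => [|j js IH] A A' /= cA nc.
  by exists A, A'; rewrite !subxx !mul1n; split => //; move: cA; rewrite expn0 mul1n.
set M := (2 ^ h * t.+1)%N in cA IH.
have M0 : (0 < M)%N by rewrite muln_gt0 expn_gt0.
have [|||A1 [A2 [A1A A2A c1 c2 f12]]] :=
  @far_or_comb K h (M ^ size js * k) t (F j) A A' K1 hK.
- by rewrite muln_gt0 expn_gt0 M0.
- by rewrite mulnA -expnS.
- by apply: nc; rewrite mem_head.
have [||B1 [B2 [B1A B2A d1 d2 fB]]] := IH A1 A2.
- exact: c1.
- by move=> i ijs /(comb_sub A1A); apply: nc; rewrite inE ijs orbT.
exists B1, B2; split => //.
- exact: subset_trans B1A A1A.
- exact: subset_trans B2A A2A.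
- by rewrite expnS -mulnA; apply: leq_trans c2 _; rewrite leq_pmul2l.
- move=> i; rewrite inE => /predU1P[->|/fB//].
  exact: far_sub B1A B2A f12.
Qed.

(** Each round finds a point far from a large cluster for all functions at once, puts it in front
    and continues inside the cluster. The point [z] lies in every cluster, so its values serve as
    limits. *)
Lemma common_comb (I : eqType) (F : I -> V -> R) (K : R) (h t : nat)
    (js : seq I) (n : nat) (S : {set V}) :
  1 <= K -> 2 * K * (4 * K + 1) <= 2 ^+ h ->
  (((2 ^ h * t.+1) ^ size js + 2 ^ size js) ^ n <= #|S|)%N ->
  (forall j, j \in js -> ~ comb K (F j) S t) ->
  exists z c, [/\ z \in S, {subset c <= S}, uniq c, size c = n &
    forall j, j \in js -> pairwise (drops K (F j z) (F j)) c].
Proof.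
move=> K1 hK; elim: n S => [|n IHn] S cS nc.
  have [z zS] : exists z, z \in S by apply/set0Pn; rewrite -card_gt0.
  by exists z, [::].
set M := ((2 ^ h * t.+1) ^ size js)%N in cS IHn *.
set J := size js in M cS IHn *.
set W := (M + 2 ^ J)%N in cS IHn.
have W0 : (0 < W ^ n)%N by rewrite expn_gt0 addn_gt0 expn_gt0 orbT.
have J0 : (0 < 2 ^ J)%N by rewrite expn_gt0.
(* These are the candidates for the front point: [2 ^ J] of them, so that one survives [J]
   halvings. *)
pose A' := [set x in take (2 ^ J) (enum S)].
have A'S : A' \subset S.
  by apply/subsetP => x; rewrite inE => /mem_take; rewrite mem_enum.
have cA' : #|A'| = (2 ^ J)%N.
  rewrite cardsE; have /card_uniqP-> : uniq (take (2 ^ J) (enum S)).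
    by rewrite take_uniq ?enum_uniq.
  rewrite size_takel // -cardE; apply: leq_trans cS; rewrite expnS /W; nia.
have cA : #|S :\: A'| = (#|S| - 2 ^ J)%N.
  by rewrite cardsD (setIidPr A'S) cA'.
have [||A1 [A2 [A1A A2A c1 c2 fA]]] :=
    @far_or_comb_all I F K h t js (W ^ n) (S :\: A') A' K1 hK W0.
- rewrite cA -/J -/M leq_subRL; last first.
    by apply: leq_trans cS; rewrite expnS /W; nia.
  by apply: leq_trans cS; rewrite expnS {2}/W; nia.
- by move=> j jjs /(comb_sub (subsetDl _ _)); apply: nc.
have A1S : A1 \subset S by apply: subset_trans A1A (subsetDl _ _).
have [|z [c [zA cA1 uc sc pc]]] := IHn A1 c1.
- by move=> j jjs /(comb_sub A1S); apply: nc.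
have [x xA2] : exists x, x \in A2.
  by apply/set0Pn; rewrite -card_gt0; move: c2; rewrite cA' -/J; nia.
exists z, (x :: c); split.
- exact: (subsetP A1S).
- move=> w; rewrite inE => /predU1P[->|/cA1/(subsetP A1S)//].
  by apply: (subsetP A'S); apply: (subsetP A2A).
- rewrite /= uc andbT; apply/negP => /cA1/(subsetP A1A).
  by rewrite inE (subsetP A2A).
- by rewrite /= sc.
- move=> j jjs; rewrite /= pc // andbT; apply/allP => y /cA1 yA1.
  rewrite /drops distrC; apply: le_trans (_ : K * `|F j z - F j y| <= _).
    by rewrite distrC.
  exact: fA.
Qed.

End Separation.

Definition rapid (R : realFieldType) (V : finType) (K : R) (f : V -> R)
    (s : seq V) : Prop :=
  exists L, pairwise (drops K L f) s \/
            pairwise (fun x y => drops K L f y x) s.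

Lemma rapid_subseq (R : realFieldType) (V : finType) (K : R) (f : V -> R)
    (s s' : seq V) : subseq s' s -> rapid K f s -> rapid K f s'.
Proof.
move=> s's [L [p|p]]; exists L; [left|right]; exact: subseq_pairwise s's p.
Qed.

Lemma pairwise_index (T : eqType) (P : rel T) (c : seq T) (x y : T) :
  pairwise P c -> x \in c -> y \in c -> (index x c < index y c)%N -> P x y.
Proof.
move=> /(pairwiseP x) Pc xc yc xy.
by have := Pc _ _ _ _ xy; rewrite !inE !index_mem !nth_index //; apply.
Qed.

(** With [T = (n * n) ^ e], each of [n] rounds costs at most [2 ^ ((h + 1 + T) * J.+1 + 1)];
    constants in the exponent are absorbed by [k < n ^ k]. *)
Lemma tower_bound (n h J e : nat) : (1 < n)%N ->
  ((((2 ^ h * (2 ^ ((n * n) ^ e)).+1) ^ J.+1 + 2 ^ J.+1) ^ n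
    <= 2 ^ (n ^ (1 + (J.+1 * (h + 2) + 1) + 2 * e)))%N).
Proof.
move=> n1; set T := ((n * n) ^ e)%N.
have T0 : (0 < T)%N by rewrite expn_gt0; nia.
have le1 : (2 ^ h * (2 ^ T).+1 <= 2 ^ (h + 1 + T))%N.
  rewrite -addnA expnD leq_mul2l; apply/orP; right.
  by rewrite add1n expnS; have := expn_gt0 2 T; lia.
have le2 : ((2 ^ h * (2 ^ T).+1) ^ J.+1 <= 2 ^ ((h + 1 + T) * J.+1))%N.
  by rewrite expnM leq_exp2r.
have le3 : (2 ^ J.+1 <= 2 ^ ((h + 1 + T) * J.+1))%N.
  by rewrite leq_exp2l // leq_pmull //; lia.
apply: leq_trans (_ : (2 ^ ((h + 1 + T) * J.+1 + 1)) ^ n <= _)%N.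
  rewrite leq_exp2r; last lia.
  by rewrite addn1 [in leqRHS]expnS; lia.
rewrite -expnM leq_exp2l // [leqLHS]mulnC [in leqRHS]expnD.
rewrite [in leqRHS]expnD expn1 -mulnA leq_mul2l; apply/orP; right.
apply: leq_trans (_ : (J.+1 * (h + 2) + 1) * T <= _)%N; first by clear -T0; nia.
apply: leq_mul.
  by apply: ltnW; exact: ltn_expl.
by rewrite /T expnM -mulnn.
Qed.

(* With [t = 2 ^ ((n * n) ^ e)]: a comb of length [t] for one function is
   refined for the other ones to length [n * n], which leaves room for making the
   new order agree with that of the comb, up to reversal. *)
Lemma simultaneous_rapid (J h : nat) : exists e : nat,
  forall (R : realFieldType) (V : finType) (I : eqType) (F : I -> V -> R)
    (K : R) (js : seq I) (n : nat) (S : {set V}),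
  size js = J -> 1 <= K -> 2 * K * (4 * K + 1) <= 2 ^+ h -> (1 < n)%N ->
  (2 ^ (n ^ e) <= #|S|)%N ->
  exists s, [/\ uniq s, size s = n, {subset s <= S} &
    forall j, j \in js -> rapid K (F j) s].
Proof.
elim: J => [|J [e IH]].
  exists 1%N => R V I F K js n S /size0nil -> K1 hK n1 cS.
  exists (take n (enum S)); split => //.
  - by rewrite take_uniq ?enum_uniq.
  - rewrite size_takel // -cardE; apply: leq_trans cS.
    by rewrite expn1 ltnW // ltn_expl.
  - by move=> x /mem_take; rewrite mem_enum.
exists (1 + (J.+1 * (h + 2) + 1) + 2 * e)%N.
move=> R V I F K js n S sJ K1 hK n1 cS.
set t := (2 ^ ((n * n) ^ e))%N.
have [[j [jjs [z [c [zS cS' uc sc pc]]]]]|nc] :=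
    pselect (exists j, j \in js /\ comb K (F j) S t); last first.
  have [||z [c [zS cS' uc sc pc]]] := @common_comb R V I F K h t js n S K1 hK.
  - by rewrite sJ; apply: leq_trans cS; exact: tower_bound.
  - by move=> j jjs cj; apply: nc; exists j.
  by exists c; split => // j /pc p; exists (F j z); left.
have [|//||s [us ss sS rs]] :=
    @IH R V I F K (rem j js) (n * n)%N [set x in c] _ K1 hK.
- by rewrite size_rem // sJ.
- by clear -n1; nia.
- by rewrite cardsE (card_uniqP uc) sc.
have {}sS x : x \in s -> x \in c by move/sS; rewrite inE.
(* As in the Erdős-Szekeres theorem: [s] may list points of the comb in another order, but a
   subsequence of length [n] follows the comb forwards or backwards. *)
have [|x y w _|s' [s's ss' ps']] :=
    @pairwise_of_trans _ (fun x y => index x c < index y c)%N s n us.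
- by rewrite ss.
- exact: ltn_trans.
have s'c x : x \in s' -> x \in c by move/(mem_subseq s's)/sS.
exists s'; split => //.
- exact: subseq_uniq s's us.
- by move=> x /s'c/cS'.
move=> i ijs; have [->|ij] := eqVneq i j; last first.
  apply: rapid_subseq s's (rs i _).
  by move: ijs; rewrite (perm_mem (perm_to_rem jjs)) inE (negPf ij).
have us' := subseq_uniq s's us.
exists (F j z); case: ps' => ps'; [left|right].
  have : all (mem c) s' by apply/allP.
  move/sub_in_pairwise; apply; last exact: ps'.
  by move=> x y xc yc; exact: pairwise_index.
have : pairwise (fun x y => (x != y) && ~~ (index x c < index y c)%N) s'.
  have := pairwise_relI (fun x y => x != y) (fun x y => ~~ (index x c < index y c)%N) s'.
  by rewrite ps' -uniq_pairwise us'.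
have : all (mem c) s' by apply/allP.
move/sub_in_pairwise; apply.
move=> x y xc yc /= /andP[xy]; rewrite -leqNgt leq_eqVlt => /orP[|]; last exact: pairwise_index.
by move=> /eqP/(congr1 (nth x c)); rewrite !nth_index // => e'; rewrite e' eqxx in xy.
Qed.

(** * Comparing rapidly monotone sequences *)

Lemma pairwise_of_cotrans (T : eqType) (P : rel T) (s : seq T) (n : nat) :
  uniq s -> (n * n <= size s)%N ->
  (forall x y z, subseq [:: x; y; z] s -> ~~ P x y -> ~~ P y z -> ~~ P x z) ->
  exists s', [/\ subseq s' s, size s' = n &
     pairwise P s' \/ pairwise (fun x y => ~~ P x y) s'].
Proof.
move=> us ns Ptr.
have [s' [s's ss' ps']] := @pairwise_of_trans _ (fun x y => ~~ P x y) s n us ns Ptr.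
exists s'; split => //; case: ps' => ps'; [by right|left].
by move: ps'; apply: sub_pairwise => x y; rewrite negbK.
Qed.

Section Domination.
Variables (R : realFieldType) (T : eqType).
Implicit Types (u v : T -> R) (s : seq T).

Definition geometric (K : R) u s : Prop :=
  pairwise (fun x y => K * u y <= u x) s \/
  pairwise (fun x y => K * u x <= u y) s.

Lemma geometric_subseq K u s s' :
  subseq s' s -> geometric K u s -> geometric K u s'.
Proof. by move=> s's [p|p]; [left|right]; exact: subseq_pairwise s's p. Qed.

Lemma triple_pairwise (P : rel T) s x y z :
  subseq [:: x; y; z] s -> pairwise P s -> [/\ P x y, P x z & P y z].
Proof.
by move=> xyz /(subseq_pairwise xyz) /=; rewrite !andbT => /andP[/andP[-> ->] ->].
Qed.

(** For fixed [x], monotonicity of [v] makes either the truth or the failure of a comparison at [y]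
    persist at all later [z]. So the relation or its complement is transitive. *)
Lemma pairwise_compare (a b : R) u v s n :
  0 <= a -> 0 <= b -> geometric 1 v s -> uniq s -> (n * n <= size s)%N ->
  (exists s', [/\ subseq s' s, size s' = n &
     pairwise (fun x y => a * u x < b * v y) s' \/
     pairwise (fun x y => b * v y <= a * u x) s']) /\
  (exists s', [/\ subseq s' s, size s' = n &
     pairwise (fun x y => b * v y < a * u x) s' \/
     pairwise (fun x y => a * u x <= b * v y) s']).
Proof.
move=> a0 b0 mv us ns.
pose P x y := a * u x < b * v y; pose Q x y := b * v y < a * u x.
have dec x y z : v z <= v y -> (~~ P x y -> ~~ P x z) /\ (Q x y -> Q x z).
  move=> zy; have := ler_wpM2l b0 zy.
  by rewrite /P /Q -!leNgt; split=> h; [apply: le_trans h|apply: le_lt_trans h].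
have e1 (s' : seq T) : pairwise (fun x y => ~~ P x y) s' ->
    pairwise (fun x y => b * v y <= a * u x) s'.
  by apply: sub_pairwise => x y; rewrite leNgt.
have e2 (s' : seq T) : pairwise (fun x y => ~~ Q x y) s' ->
    pairwise (fun x y => a * u x <= b * v y) s'.
  by apply: sub_pairwise => x y; rewrite leNgt.
case: mv => mv; split.
- have [x y z xyz Pxy _|s' [h1 h2 h3]] := @pairwise_of_cotrans _ P s n us ns.
    have [_ _] := triple_pairwise xyz mv; rewrite mul1r.
    by case/(dec x) => /(_ Pxy).
  by exists s'; split => //; case: h3 => [|/e1]; [left|right].
- have [x y z xyz Pxy _|s' [h1 h2 h3]] := @pairwise_of_trans _ Q s n us ns.
    have [_ _] := triple_pairwise xyz mv; rewrite mul1r.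
    by case/(dec x) => _ /(_ Pxy).
  by exists s'; split => //; case: h3 => [|/e2]; [left|right].
- have [x y z xyz Pxy _|s' [h1 h2 h3]] := @pairwise_of_trans _ P s n us ns.
    have [_ _] := triple_pairwise xyz mv; rewrite mul1r => yz.
    by move: Pxy; apply: contraTT; case: (dec x _ _ yz).
  by exists s'; split => //; case: h3 => [|/e1]; [left|right].
- have [x y z xyz Pxy _|s' [h1 h2 h3]] := @pairwise_of_cotrans _ Q s n us ns.
    have [_ _] := triple_pairwise xyz mv; rewrite mul1r => yz.
    by move: Pxy; apply: contraNN; case: (dec x _ _ yz).
  by exists s'; split => //; case: h3 => [|/e2]; [left|right].
Qed.

Definition dominated (rho : R) u v s : Prop :=
  pairwise (fun x y => rho * u x <= v y) s \/
  pairwise (fun x y => rho * v y <= u x) s.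

(* If [u x] and [v y] are within a factor [rho] of each other for all [x] before
   [y], then the terms of a [K]-geometric sequence are pairwise within a factor
   [rho ^ 2 < K] of each other, so they vanish. The first vertex [w] provides the
   second index needed for this comparison and is dropped. *)
Lemma subseq_dominated (rho K : R) u v s (n : nat) :
  1 <= rho -> rho ^+ 2 < K -> (forall x, 0 <= u x) -> (forall x, 0 <= v x) ->
  geometric 1 v s -> geometric K u s \/ geometric K v s -> uniq s ->
  (1 < n)%N -> (n ^ 8 <= size s)%N ->
  exists s', [/\ subseq s' s, size s' = n & dominated rho u v s'].
Proof.
move=> r1 rK u0 v0 mv gu us n1 ns.
have r0 : 0 <= rho by lra.
have [|[s1 [s1s ss1 ps1]] _] :=
    @pairwise_compare rho 1 u v s (n ^ 4) r0 ler01 mv us.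
  by rewrite -expnD.
have us1 := subseq_uniq s1s us; have mv1 := geometric_subseq s1s mv.
have shrink m (s0 : seq T) : (n <= m)%N -> size s0 = m -> subseq s0 s ->
    dominated rho u v s0 ->
    exists s', [/\ subseq s' s, size s' = n & dominated rho u v s'].
  move=> nm s0m s0s d; have [|s' s's0 ss'] := @subseq_of_size _ s0 n.
    by rewrite s0m.
  exists s'; split => //; first exact: subseq_trans s's0 s0s.
  by case: d => p; [left|right]; exact: subseq_pairwise s's0 p.
case: ps1 => ps1.
  apply: (shrink (n ^ 4)%N s1) => //; first by rewrite -[leqLHS]expn1 leq_exp2l.
  left; move: ps1; apply: sub_pairwise => x y; rewrite mul1r; exact: ltW.
have [|_ [s2 [s2s1 ss2 ps2]]] :=
    @pairwise_compare 1 rho u v s1 (n * n) ler01 r0 mv1 us1.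
  by rewrite ss1 !mulnn -expnM.
have s2s := subseq_trans s2s1 s1s.
have n_nn : (n < n * n)%N by rewrite -[ltnLHS]muln1 ltn_pmul2l // ltnW.
case: ps2 => ps2.
  apply: (shrink (n * n)%N s2) => //; first exact: ltnW.
  right; move: ps2; apply: sub_pairwise => x y; rewrite mul1r; exact: ltW.
have {}ps1 := subseq_pairwise s2s1 ps1.
case: s2 ss2 s2s ps1 ps2 {s2s1} => [|w s2]; first by move=> /= e; rewrite -e in n_nn.
move=> [ss2] ws2s ps1 ps2.
have s2s := subseq_trans (subseq_cons s2 w) ws2s.
apply: (shrink (size s2) s2) => //; first by move: n_nn; rewrite -ss2 ltnS.
left; apply/(pairwiseP w) => i j; rewrite !inE => im jm ij.
set x := nth w s2 i; set y := nth w s2 j.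
have wxy : subseq [:: w; x; y] (w :: s2).
  rewrite /= eqxx -[s2](cat_take_drop j) -cat1s.
  apply: (@cat_subseq _ [:: x] [:: y]); rewrite sub1seq.
    by rewrite /x -(nth_take w ij) mem_nth // size_take jm.
  by rewrite (drop_nth w jm) mem_head.
have [] := triple_pairwise wxy ps1; rewrite !mul1r => a1 a2 a3.
have [] := triple_pairwise wxy ps2; rewrite !mul1r => b1 b2 b3.
have zero (a b c : R) : 0 <= a -> K * a <= b -> b <= rho * c ->
    c <= rho * a -> a = 0.
  move=> a0 ab bc ca; have := ler_wpM2l r0 ca; rewrite mulrA => rca.
  have [//|an0] := eqVneq a 0.
  have : 0 < (K - rho ^+ 2) * a by rewrite mulr_gt0 ?subr_gt0 // lt_def an0.
  by rewrite mulrBl expr2; lra.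
(* It suffices that [v y] vanishes, since [u x <= rho * v y]. The four cases below are the choice of
   the [K]-geometric sequence and its direction. *)
have vy0 : v y <= 0 -> rho * u x <= v y.
  move=> vy; have {}vy : v y = 0 by apply/le_anti; rewrite vy v0.
  have ux : u x <= 0 by rewrite (le_trans b3) // vy mulr0.
  by rewrite vy (_ : u x = 0) ?mulr0 //; apply/le_anti; rewrite ux u0.
case: gu => -[] /(subseq_pairwise ws2s)/(triple_pairwise wxy)[h1 h2 h3].
- by apply: vy0; move: (a3); rewrite (zero _ _ _ (u0 x) h1 b2 a3) mulr0.
- by apply: vy0; move: (a2); rewrite (zero _ _ _ (u0 w) h1 b3 a2) mulr0.
- by apply: vy0; rewrite (zero _ _ _ (v0 y) h3 a1 b2).
- apply: vy0; rewrite (le_trans a2) //.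
  have vx := zero _ _ _ (v0 x) h3 a2 b1.
  by move: b1; rewrite vx mulr0 => /(ler_wpM2l r0); rewrite mulr0.
Qed.

End Domination.

(** * Signs of sums with a dominant term *)

Lemma sgr_dominant (R : realFieldType) (a b : R) :
  `|b| < `|a| -> Num.sg (a + b) = Num.sg a.
Proof.
rewrite ltr_norml; case: (ltrgt0P a) => [a0|a0|->] /andP[h1 h2].
- by rewrite !gtr0_sg //; lra.
- by rewrite !ltr0_sg //; lra.
- by move: h1 h2; lra.
Qed.

(** A largest nonzero term exceeds each other one by the factor [rho], and there are fewer than
    [rho] others, so it fixes the sign. The directions of domination agree for [t] and [t'], so the
    same index decides both sums. *)
Lemma sgr_sum_dominated (R : realFieldType) (I : finType) (rho : R)
    (t t' : I -> R) :
  1 < rho -> #|I|%:R <= rho ->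
  (forall a, Num.sg (t a) = Num.sg (t' a)) ->
  (forall a b, a != b ->
     (rho * `|t a| <= `|t b| /\ rho * `|t' a| <= `|t' b|) \/
     (rho * `|t b| <= `|t a| /\ rho * `|t' b| <= `|t' a|)) ->
  Num.sg (\sum_a t a) = Num.sg (\sum_a t' a).
Proof.
move=> r1 Ir sgt dom.
have [a0 _|I0] := pickP I; last by rewrite !big_pred0.
case: (@arg_maxP _ _ _ a0 predT (fun a => `|t a|) isT) => a _ amax.
have [ta0|ta0] := eqVneq (t a) 0.
  have t0 b : t b = 0.
    by have := amax b isT; rewrite /= ta0 normr0 normr_le0 => /eqP.
  rewrite !big1 // => b _; apply/eqP.
  by rewrite -sgr_eq0 -sgt t0 sgr0.
have na : 0 < `|t a| by rewrite normr_gt0.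
have lt b : b != a -> rho * `|t b| <= `|t a| /\ rho * `|t' b| <= `|t' a|.
  move=> ba; case: (dom _ _ ba) => // -[h _].
  have := amax b isT; have : 0 < (rho - 1) * `|t a| by rewrite mulr_gt0 ?subr_gt0.
  rewrite mulrBl mul1r /=; lra.
have fin (f : I -> R) : 0 < `|f a| -> (forall b, b != a -> rho * `|f b| <= `|f a|) ->
    Num.sg (\sum_b f b) = Num.sg (f a).
  move=> fa fb; rewrite (bigD1 a) //=; apply: sgr_dominant.
  have r0 : 0 < rho by lra.
  apply: le_lt_trans (ler_norm_sum _ _ _) _.
  rewrite -(ltr_pM2l r0) mulr_sumr.
  apply: le_lt_trans (_ : \sum_(b | b != a) `|f a| < _).
    by apply: ler_sum => b; exact: fb.
  rewrite sumr_const -mulr_natl ltr_pM2r //.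
  apply: lt_le_trans Ir; rewrite ltr_nat (cardD1 a predT) inE add1n ltnS.
  by apply/subset_leq_card/subsetP => b; rewrite !inE andbT.
rewrite !fin // => [|b /lt[//]|b /lt[//]].
by rewrite normr_gt0 -sgr_eq0 -sgt sgr_eq0.
Qed.

(** Properties inherited by subsequences can be secured one after another; the exponents
    multiply. *)
Lemma subseq_iterate (T : eqType) (I : eqType) (G : seq T -> Prop)
    (pi : I -> seq T -> Prop) (e : nat) :
  (0 < e)%N ->
  (forall s s', subseq s' s -> G s -> G s') ->
  (forall i s s', subseq s' s -> pi i s -> pi i s') ->
  (forall i s n, uniq s -> G s -> (1 < n)%N -> (n ^ e <= size s)%N ->
    exists s', [/\ subseq s' s, size s' = n & pi i s']) ->
  forall (js : seq I) s n, uniq s -> G s -> (1 < n)%N ->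
    (n ^ (e ^ size js) <= size s)%N ->
    exists s', [/\ subseq s' s, size s' = n & forall i, i \in js -> pi i s'].
Proof.
move=> e0 Gs pis step; elim=> [|j js IH] s n us gs n1 /= ns.
  have [s' s's ss'] := subseq_of_size ns.
  by exists s'; rewrite ss' expn0 expn1.
have [||s1 [s1s ss1 p1]] := step j s (n ^ (e ^ size js))%N us gs.
- by rewrite -[ltnLHS](expn0 n) ltn_exp2l // expn_gt0 e0.
- by rewrite -expnM -expnSr.
have [|s2 [s2s1 ss2 p2]] := IH s1 n (subseq_uniq s1s us) (Gs _ _ s1s gs) n1.
  by rewrite ss1.
exists s2; split => //; first exact: subseq_trans s2s1 s1s.
by move=> i; rewrite inE => /predU1P[->|/p2//]; exact: pis s2s1 p1.
Qed.

(** The constant [c + \sum_b L b] competes as one more term with the [r] deviations. Position [a]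
    precedes position [b] in both tuples, so [dominated] gives both the same direction. *)
Lemma sgr_affine_subseq (R : realFieldType) (T : eqType) (r : nat)
    (F : 'I_r -> T -> R) (L : 'I_r -> R) (c rho : R) (s t t' : seq T) (x0 : T) :
  1 < rho -> r.+1%:R <= rho ->
  (forall a b, dominated rho (fun x => `|F a x - L a|) (fun x => `|F b x - L b|) s) ->
  (forall a, (forall x, x \in s -> rho * `|F a x - L a| <= `|c + \sum_b L b|) \/
     (forall x, x \in s -> rho * `|c + \sum_b L b| <= `|F a x - L a|)) ->
  (forall a, {in s &, forall x y, Num.sg (F a x - L a) = Num.sg (F a y - L a)}) ->
  subseq t s -> subseq t' s -> size t = r -> size t' = r ->
  Num.sg (c + \sum_a F a (nth x0 t a)) = Num.sg (c + \sum_a F a (nth x0 t' a)).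
Proof.
move=> r1 rr dom domc sgs ts t's st st'.
pose val (t : seq T) (i : 'I_r.+1) := if unlift ord0 i is Some a
  then F a (nth x0 t a) - L a else c + \sum_b L b.
have sum_val u : c + \sum_a F a (nth x0 u a) = \sum_i val u i.
  rewrite big_ord_recl /val unlift_none -addrA -big_split /=; congr (_ + _).
  by apply: eq_bigr => a _; rewrite liftK addrC subrK.
have mem u (a : 'I_r) : subseq u s -> size u = r -> nth x0 u a \in s.
  by move=> us su; apply: (mem_subseq us); rewrite mem_nth ?su.
rewrite !sum_val; apply: (@sgr_sum_dominated _ _ rho) => //.
- by rewrite card_ord.
- move=> i; rewrite /val; case: (unlift ord0 i) => [a|//].
  by apply: sgs; exact: mem.
have domlt (a b : 'I_r) : (a < b)%N ->
    (forall u, subseq u s -> size u = r ->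
      rho * `|F a (nth x0 u a) - L a| <= `|F b (nth x0 u b) - L b|) \/
    (forall u, subseq u s -> size u = r ->
      rho * `|F b (nth x0 u b) - L b| <= `|F a (nth x0 u a) - L a|).
  move=> ab; case: (dom a b) => p; [left|right] => u us su.
    have /(pairwiseP x0) := subseq_pairwise us p.
    by move=> /(_ a b); rewrite !inE su !ltn_ord; apply.
  have /(pairwiseP x0) := subseq_pairwise us p.
  by move=> /(_ a b); rewrite !inE su !ltn_ord; apply.
move=> i j ij; rewrite /val.
case: unliftP ij => [a ->|->]; case: unliftP => [b ->|->]; rewrite ?eqxx //.
- rewrite (inj_eq lift_inj) neq_ltn => /orP[/domlt[]|/domlt[]] h.
  + by left; split; apply: h.
  + by right; split; apply: h.
  + by right; split; apply: h.
  + by left; split; apply: h.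
- by move=> _; case: (domc a) => h; [left|right]; split; apply: h; exact: mem.
- by move=> _; case: (domc b) => h; [right|left]; split; apply: h; exact: mem.
Qed.

(** * Semilinear colorings *)

Lemma meval_affine (R : comNzRingType) (n : nat) (f : mpoly n R) :
  (msize f <= 2)%N ->
  exists cg : R * ('I_n -> R), forall v : 'I_n -> R,
    meval v f = cg.1 + \sum_i cg.2 i * v i.
Proof.
move=> f2.
have : forall m, m \in msupp f -> (mdeg m <= 1)%N.
  by move=> m /msize_mdeg_lt mf; rewrite -ltnS (leq_trans mf).
(* As a sum over [msupp f], the evaluation allows induction on the list while the coefficients stay
   those of [f]. *)
under [X in _ -> X]eq_exists => cg do under eq_forall => v do rewrite mevalE.
move: (msupp f) => {f2}; elim=> [|m ms IH] ms1.
  by exists (0, fun=> 0) => v; rewrite big_nil big1 ?addr0 // => i _; rewrite mul0r.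
have [|[c g] /= IHv] := IH; first by move=> m' m'ms; apply: ms1; rewrite inE m'ms orbT.
have := ms1 m (mem_head _ _); rewrite leq_eqVlt ltnS leqn0 => /orP[|].
  case/mdeg1P => i /eqP->.
  exists (c, fun j => g j + (if j == i then mcoeff (mnm1 i) f else 0)) => v /=.
  rewrite big_cons IHv; under [in RHS]eq_bigr do rewrite mulrDl.
  rewrite big_split /= [X in _ = _ + (_ + X)](bigD1 i) //= eqxx
    [X in _ + (_ + (_ + X))]big1; last first.
    by move=> j /negPf->; rewrite mul0r.
  rewrite -mevalX mevalXU; ring.
rewrite mdeg_eq0 => /eqP->.
exists (c + mcoeff 0%MM f, g) => v /=.
rewrite big_cons IHv -mevalX mpolyX0 meval1; ring.
Qed.

(** [idx] is the position in the enumeration, and [F l a x] collects the linear terms of [f l] in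
    the coordinates of [x] placed in row [a]. *)
Lemma semialgebraic_affine (R : realType) (r d m : nat) (V : finType)
    (E : {set {set V}}) :
  semialgebraic R r d 1 m E ->
  exists (idx : V -> nat) (F : 'I_m -> 'I_r -> V -> R) (c : 'I_m -> R)
    (Phi : {ffun 'I_m -> sign} -> bool),
    injective idx /\
    forall x : 'I_r -> V,
      (forall a b : 'I_r, (a < b)%N -> (idx (x a) < idx (x b))%N) ->
      ([set x a | a : 'I_r] \in E) =
      Phi [ffun l => sign_of (c l + \sum_a F l a (x a))].
Proof.
move=> [v [pt [f [Phi [[v' vK v'K] f1 fE]]]]].
have [cg cgP] := choice (fun l => meval_affine (f1 l)).
exists (fun x => v' x : nat).
exists (fun l a x => \sum_(b < d) (cg l).2 (mxvec_index a b) * pt (v' x) 0 b).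
exists (fun l => (cg l).1), Phi; split.
  by move=> x y /ord_inj /(can_inj v'K).
move=> x xlt; have := fE (v' \o x) xlt.
rewrite (_ : [set _ | a : 'I_r] = [set x a | a : 'I_r]); last first.
  by apply: eq_imset => a /=; rewrite v'K.
move->; congr Phi; apply/ffunP => l; rewrite !ffunE; congr sign_of.
rewrite /eval_rows cgP; congr (_ + _).
rewrite (reindex _ (curry_mxvec_bij _ _)) /= pair_big /=.
by apply: eq_bigr => -[a b] _ /=; rewrite mxvecE mxE.
Qed.

Lemma pairwise_rev (T : Type) (P : rel T) (s : seq T) :
  pairwise P (rev s) = pairwise (fun x y => P y x) s.
Proof.
by elim: s => //= x s IH; rewrite rev_cons pairwise_rcons all_rev IH.
Qed.

Lemma geometric_le (R : realFieldType) (T : eqType) (K1 K2 : R) (u : T -> R)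
    (s : seq T) :
  (forall x, 0 <= u x) -> K1 <= K2 -> geometric K2 u s -> geometric K1 u s.
Proof.
move=> u0 K12 [] p; [left|right]; move: p; apply: sub_pairwise => x y.
  by apply: le_trans; rewrite ler_wpM2r.
by apply: le_trans; rewrite ler_wpM2r.
Qed.

Lemma pairwise_inj_lt (T : eqType) (f : T -> nat) (s : seq T) :
  injective f -> uniq s -> pairwise (fun x y => ~~ (f x < f y)%N) s ->
  pairwise (fun x y => (f y < f x)%N) s.
Proof.
move=> finj us ps.
have := pairwise_relI (fun x y => x != y) (fun x y => ~~ (f x < f y)%N) s.
rewrite ps -uniq_pairwise us /=; apply: sub_pairwise => x y /= /andP[xy].
by rewrite -leqNgt leq_eqVlt (inj_eq finj) eq_sym (negPf xy).
Qed.

(** Each color class has its own enumeration of the vertices; one sequence has to suit them all. *)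
Definition monotone_along (T : eqType) (f : T -> nat) (s : seq T) : Prop :=
  pairwise (fun x y => (f x < f y)%N) s \/ pairwise (fun x y => (f y < f x)%N) s.

Definition homogeneous (T : eqType) (q : pred T) (s : seq T) : Prop :=
  pairwise (fun x y => q x) s \/ pairwise (fun x y => ~~ q x) s.

Lemma subseq_structured (r m p : nat) : exists e : nat,
  forall (R : realFieldType) (V : finType) (idx : 'I_p -> V -> nat)
    (F : 'I_p -> 'I_m -> 'I_r -> V -> R) (c : 'I_p -> 'I_m -> R) (n : nat),
  (forall k, injective (idx k)) -> (1 < n)%N -> (2 ^ (n ^ e) <= #|V|)%N ->
  exists (s : seq V) (L : 'I_p -> 'I_m -> 'I_r -> R),
  [/\ uniq s, size s = n, forall k, monotone_along (idx k) s &
   forall k l, let u a x := F k l a x - L k l a in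
     let C := c k l + \sum_a L k l a in
     [/\ forall a b,
           dominated r.+2%:R (fun x => `|u a x|) (fun x => `|u b x|) s,
         forall a, (forall x, x \in s -> r.+2%:R * `|u a x| <= `|C|) \/
                   (forall x, x \in s -> r.+2%:R * `|C| <= `|u a x|) &
         forall a, {in s &, forall x y, Num.sg (u a x) = Num.sg (u a y)}]].
Proof.
pose Q := ('I_p * 'I_m * 'I_r)%type.
(* One refinement per entry: enumerations, pairs of deviations, deviations against constants, and
   signs, where the boolean selects [u] or [- u]. *)
pose J := (('I_p + Q * 'I_r) + (Q + Q * bool))%type.
(* [K] exceeds the square of [rho = r + 2], as [subseq_dominated] demands; [h] works because
   [h < 2 ^ h]. *)
pose K := (r.+2 ^ 2 + 1)%N; pose h := (2 * K * (4 * K + 1))%N.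
have [e0 He0] := simultaneous_rapid #|{: Q}| h.
(* The factors come from starting with [n * n] in order to drop a vertex, from the exponent 8 of
   each refinement, and from rapid convergence. *)
exists (2 * 8 ^ #|{: J}| * e0)%N => R V idx F c n idx_inj n1 cV.
set rho : R := r.+2%:R.
have rhoK : rho ^+ 2 < K%:R by rewrite -natrX ltr_nat /K addn1.
have rho1 : 1 <= rho by rewrite ler1n.
have K1 : 1 <= K%:R :> R by rewrite ler1n /K addn1.
have hK : 2 * K%:R * (4 * K%:R + 1) <= 2 ^+ h :> R.
  rewrite -natrX -!natrM natr1 -natrM ler_nat.
  by apply: leq_trans (ltnW (ltn_expl h (ltnSn 1))); rewrite /h addn1.
(* The comparisons with constants and the signs are encoded as relations
   depending on one vertex only, which say nothing about the last vertex of the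
   sequence: it is removed at the end. *)
have nn1 : (1 < n * n)%N by clear -n1; nia.
pose n0 := ((n * n) ^ (8 ^ #|{: J}|))%N.
have [|||||s0 [us0 ss0 _ rs0]] := He0 R V Q (fun q => F q.1.1 q.1.2 q.2) K%:R
  (enum {: Q}) n0 [set: V].
- by rewrite -cardE.
- exact: K1.
- exact: hK.
- by rewrite -[ltnLHS](expn0 (n * n)) ltn_exp2l // expn_gt0.
- by rewrite cardsT /n0 mulnn -!expnM mulnA.
have [L LP] := choice (fun q => rs0 q (mem_enum _ q)).
pose u (q : Q) x := F q.1.1 q.1.2 q.2 x - L q.
pose C k l := c k l + \sum_a L (k, l, a).
pose G (s : seq V) := forall q, geometric K%:R (fun x => `|u q x|) s.
pose pi (j : J) (s : seq V) := match j with
  | inl (inl k) => monotone_along (idx k) s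
  | inl (inr (q, b)) =>
      dominated rho (fun x => `|u q x|) (fun x => `|u (q.1, b) x|) s
  | inr (inl q) => dominated rho (fun x => `|u q x|) (fun=> `|C q.1.1 q.1.2|) s
  | inr (inr (q, b)) => homogeneous (fun x => 0 < (if b then u q x else - u q x)) s
  end.
have norm0 q x : 0 <= `|u q x| by [].
have [|s s' s's gs q||||s1 [s1s0 ss1 pis]] :=
    @subseq_iterate _ J G pi 8 _ _ _ _ (enum {: J}) s0 (n * n) us0 LP nn1.
- by [].
- exact: geometric_subseq s's (gs q).
- by case=> [[k|[q b]]|[q|[q b]]] s s' s's /= [] ?;
    [left|right|left|right|left|right|left|right]; apply: subseq_pairwise s's _.
- move=> j s n' us gs n'1 ns.
  have ns2 : (n' * n' <= size s)%N.
    by apply: leq_trans ns; rewrite mulnn leq_exp2l.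
  case: j => [[k|[q b]]|[q|[q b]]] /=.
  + have [x y z _|s' [s's ss' ps']] :=
        @pairwise_of_trans _ (fun x y => idx k x < idx k y)%N s n' us ns2.
      exact: ltn_trans.
    exists s'; split => //; case: ps' => ps'; [by left|right].
    exact: pairwise_inj_lt (idx_inj k) (subseq_uniq s's us) ps'.
  + apply: (@subseq_dominated _ _ rho K%:R) => //; last by left; exact: gs.
    exact: geometric_le K1 (gs _).
  + apply: (@subseq_dominated _ _ rho K%:R) => //; last by left; exact: gs.
    (* A constant sequence is geometric with ratio 1. *)
    left; elim: (s) => //= x s' ->; rewrite andbT.
    by apply/allP => y _; rewrite mul1r.
  + exact: (@pairwise_of_trans _ (fun x y => 0 < (if b then u q x else - u q x)) s n' us ns2).
- by rewrite -cardE ss0.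
have {}pis j := pis j (mem_enum _ j).
have us1 := subseq_uniq s1s0 us0.
case/lastP: s1 => [|s1 z] in ss1 us1 pis {s1s0} *; first by rewrite -ss1 in nn1.
rewrite size_rcons in ss1.
have nn : (n < n * n)%N by rewrite -[ltnLHS]muln1 ltn_pmul2l // ltnW.
have [|s ss1' ss] := @subseq_of_size _ s1 n; first by rewrite -ltnS ss1.
have s_sub : subseq s (rcons s1 z) by apply: subseq_trans ss1' (subseq_rcons _ _).
have in_s1 x : x \in s -> x \in s1 by exact: (mem_subseq ss1').
exists s, (fun k l a => L (k, l, a)); split => //.
- exact: subseq_uniq s_sub us1.
- by move=> k; case: (pis (inl (inl k))) => p1; [left|right]; exact: subseq_pairwise s_sub p1.
move=> k l; split.
- by move=> a b; case: (pis (inl (inr ((k, l, a), b)))) => p1; [left|right];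
    exact: subseq_pairwise s_sub p1.
- move=> a; case: (pis (inr (inl (k, l, a)))) => /=; rewrite pairwise_rcons => /andP[/allP p1 _].
    by left => x /in_s1/p1.
  by right => x /in_s1/p1.
move=> a x y /in_s1 xs /in_s1 ys.
have hom b : (0 < (if b then u (k, l, a) x else - u (k, l, a) x)) =
             (0 < (if b then u (k, l, a) y else - u (k, l, a) y)).
  case: (pis (inr (inr ((k, l, a), b)))) => /=; rewrite pairwise_rcons => /andP[/allP p1 _].
    by rewrite (p1 _ xs) (p1 _ ys).
  by rewrite (negPf (p1 _ xs)) (negPf (p1 _ ys)).
have /= := hom true; have /= := hom false; rewrite !oppr_gt0 /u /=.
case: (ltrgt0P (F k l a x - _)) => hx; case: (ltrgt0P (F k l a y - _)) => hy // _ _.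
- by rewrite !gtr0_sg.
- by rewrite !ltr0_sg.
- by rewrite hx hy.
Qed.

Lemma sign_of_sgr (R : realType) (x y : R) :
  Num.sg x = Num.sg y -> sign_of x = sign_of y.
Proof.
by move=> xy; rewrite /sign_of -(sgr_gt0 x) -(sgr_lt0 x) xy sgr_gt0 sgr_lt0.
Qed.

(** One sequence serves all colors, so the color can be chosen afterwards as any color of one
    [r]-subset [f0]. Every other [r]-subset yields the same signs, hence lies in the same class. *)
Lemma clique_of_size (r d m p : nat) :
  (0 < r)%N -> (0 < p)%N ->
  exists e : nat, forall (R : realType) (V : finType)
    (col : {set V} -> {set 'I_p}) (n : nat),
  (1 < n)%N -> (2 ^ (n ^ e) <= #|V|)%N -> covers_edges r col ->
  (forall k : 'I_p, semialgebraic R r d 1 m (color_class r col k)) ->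
  exists C : {set V}, monochromatic_clique r col C /\ #|C| = n.
Proof.
move=> r0 p0; have [e He] := subseq_structured r m p; exists e.
move=> R V col n n1 cV cov sa.
have [idx H1] := choice (fun k => semialgebraic_affine (sa k)).
have [F H2] := choice H1; have [c H3] := choice H2.
have [Phi H4] := choice H3.
have [|s [L [us ss mono str]]] := He R V idx F c n _ n1 cV.
  by move=> k; case: (H4 k).
exists [set x in s]; split; last by rewrite cardsE (card_uniqP us).
have [[f0 [f0s f0r]]|no] :=
    pselect (exists f : {set V}, f \subset [set x in s] /\ #|f| = r); last first.
  by exists (Ordinal p0) => f fs fr; case: no; exists f.
have /set0Pn[k kf0] := cov _ f0r.
exists k => f fs fr.
suff : (f \in color_class r col k) = (f0 \in color_class r col k).
  by rewrite !inE fr f0r kf0 eqxx.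
have [x0 _] : exists x, x \in f0 by apply/set0Pn; rewrite -card_gt0 f0r.
(* If the enumeration of color [k] decreases along [s], reverse [s]; this swaps the two terms in
   each domination. *)
have [s' [s's us' ms' str']] : exists s' : seq V,
    [/\ s' =i s, uniq s', pairwise (fun x y => (idx k x < idx k y)%N) s' &
     forall l a b, dominated r.+2%:R (fun x => `|F k l a x - L k l a|)
       (fun x => `|F k l b x - L k l b|) s'].
  case: (mono k) => ms.
    by exists s; split => // l a b; case: (str k l).
  exists (rev s); split; rewrite ?rev_uniq ?pairwise_rev //.
    by move=> x; rewrite mem_rev.
  move=> l a b; have [dom _ _] := str k l.
  by case: (dom b a); [right|left]; rewrite pairwise_rev.
pose t (g : {set V}) := [seq x <- s' | x \in g].
have st g : subseq (t g) s' by exact: filter_subseq.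
have tP (g : {set V}) : g \subset [set x in s] -> #|g| = r ->
    size (t g) = r /\ g = [set nth x0 (t g) a | a : 'I_r].
  move=> /subsetP gs gr.
  have tg x : (x \in t g) = (x \in g).
    rewrite mem_filter s's; case xg: (x \in g) => //=.
    by have := gs _ xg; rewrite inE.
  have szt : size (t g) = r.
    by rewrite -gr -(card_uniqP (filter_uniq _ us')); apply: eq_card.
  split => //; apply/setP => x; rewrite -tg; apply/idP/imsetP => [xt|[a _ ->]].
    have xr : (index x (t g) < r)%N by rewrite -szt index_mem.
    by exists (Ordinal xr); rewrite //= nth_index.
  by rewrite mem_nth // szt.
have eqPhi (g : {set V}) : g \subset [set x in s] -> #|g| = r ->
    (g \in color_class r col k) = Phi k [ffun l => sign_of (c k l +
       \sum_a F k l a (nth x0 (t g) a))].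
  move=> gs gr; have [szt {1}->] := tP g gs gr.
  have [_ ->//] := H4 k.
  move=> a b ab; have /(pairwiseP x0) := subseq_pairwise (st g) ms'.
  by move=> /(_ a b); rewrite !inE szt !ltn_ord; apply.
rewrite !eqPhi //; congr Phi; apply/ffunP => l; rewrite !ffunE.
apply: sign_of_sgr; have [_ domc sgs] := str k l.
apply: (@sgr_affine_subseq R V r (F k l) (L k l) _ r.+2%:R s') => //.
- by rewrite ltr1n.
- by rewrite ler_nat.
- by move=> a; case: (domc a) => h; [left|right] => x; rewrite s's; apply: h.
- by move=> a x y; rewrite !s's; apply: sgs.
- by case: (tP f fs fr).
- by case: (tP f0 f0s f0r).
Qed.

(** * Small vertex sets and the final exponent *)

Lemma powR_ln_le (R : realType) (N n E : nat) : (0 < E)%N ->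
  (N <= 2 ^ (n ^ E))%N -> powR (ln (N%:R : R)) E%:R^-1 <= n%:R.
Proof.
move=> E0 NE.
have En0 : E%:R != 0 :> R by rewrite pnatr_eq0 -lt0n.
have -> : n%:R = powR (powR (n%:R : R) E%:R) E%:R^-1.
  by rewrite -powRrM divff // powRr1.
have [->|N0] := posnP N.
  (* Here [ln] takes its default value 0. *)
  by rewrite ln0 // powR0 ?powR_ge0 // invr_eq0.
apply: ge0_ler_powR; rewrite ?nnegrE ?powR_ge0 ?invr_ge0 //.
  by rewrite ln_ge0 // ler1n.
rewrite powR_mulrn // -natrX -[leRHS]expRK.
rewrite ler_ln ?posrE ?expR_gt0 ?ltr0n //.
apply: le_trans (_ : (2 ^ (n ^ E))%:R <= _); first by rewrite ler_nat.
have -> : expR (n ^ E)%:R = expR 1 ^+ (n ^ E) :> R by rewrite -expRM_natl mulr1.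
rewrite natrX.
(* Base 2 is replaced by base [expR 1], using [1 + 1 <= expR 1]. *)
by rewrite lerXn2r ?nnegrE ?expR_ge0 // (le_trans _ (expR_ge1Dx 1)).
Qed.

(** The only possible [r]-subset of [C] is [C] itself. *)
Lemma small_monochromatic (r p : nat) (V : finType)
    (col : {set V} -> {set 'I_p}) (C : {set V}) :
  (0 < p)%N -> covers_edges r col -> (#|C| <= r)%N ->
  monochromatic_clique r col C.
Proof.
move=> p0 cov; rewrite leq_eqVlt => /predU1P[Cr|Cr].
  have /set0Pn[k kC] := cov _ Cr.
  exists k => e eC er; suff -> : e = C by [].
  by apply/eqP; rewrite eqEcard eC er Cr leqnn.
exists (Ordinal p0) => e /subset_leq_card + er.
by rewrite er leqNgt Cr.
Qed.

(** For [r >= 2] any pair will do; for [r = 1] there are more vertices than colors, and the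
    pigeonhole principle applies. *)
Lemma monochromatic_pair (r p : nat) (V : finType)
    (col : {set V} -> {set 'I_p}) :
  (0 < r)%N -> (0 < p)%N -> covers_edges r col -> (2 < #|V|)%N ->
  ~ (r = 1%N /\ (3 <= #|V| <= p)%N) ->
  exists C : {set V}, monochromatic_clique r col C /\ #|C| = 2%N.
Proof.
move=> r0 p0 cov V2 exc.
have [r1|r2] := leqP r 1; last first.
  exists [set x in take 2 (enum V)].
  have c2 : #|[set x in take 2 (enum V)]| = 2%N.
    rewrite cardsE (card_uniqP (take_uniq _ (enum_uniq _))) size_takel //.
    by rewrite -cardE ltnW.
  by split => //; apply: small_monochromatic => //; rewrite c2.
have {r1 r0}r1 : r = 1%N by lia.
have ne x : exists k, k \in col [set x].
  by apply/set0Pn/cov; rewrite cards1 r1.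
have [f fP] := choice ne.
have /injectivePn[x [y xy fxy]] : ~~ injectiveb f.
  apply/negP => /injectiveP/leq_card; rewrite card_ord => Vp.
  by apply: exc; rewrite r1 V2 Vp.
exists [set x; y]; split; last by rewrite cards2 xy.
exists (f x) => e exy; rewrite r1 => /eqP/cards1P[z ez].
have : z \in [set x; y] by rewrite (subsetP exy) // ez set11.
by rewrite ez !inE => /orP[]/eqP->; [|rewrite fxy]; exact: fP.
Qed.

(* The excluded case r = 1, 3 <= N <= p is exactly the one in which the     *)
(* inequality fails: N vertices with pairwise distinct colors only have     *)
(* monochromatic cliques of size at most 1, whereas ln N > 1.               *)
Theorem theorem5 (R : realType) (r d m p : nat)
    (hr : (0 < r)%N) (hd : (0 < d)%N) (hm : (0 < m)%N) (hp : (0 < p)%N) :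
  exists c : R, 0 < c /\
    forall (N : nat) (V : finType) (col : {set V} -> {set 'I_p}),
      #|V| = N ->
      ~ (r = 1%N /\ (3 <= N <= p)%N) ->
      covers_edges r col ->
      (forall k : 'I_p, semialgebraic R r d 1 m (color_class r col k)) ->
      exists C : {set V},
        monochromatic_clique r col C /\
        powR (ln (N%:R : R)) c <= #|C|%:R.
Proof.
have [e He] := clique_of_size d m hr hp.
(* The factor 2 bridges consecutive values of [n], as [n.+1 <= n ^ 2] for [n >= 2]; the successor
   makes the exponent positive, so that a maximal [n] exists. *)
pose E := (2 * e.+1)%N.
have E0 : (0 < E)%N by [].
exists E%:R^-1; split; first by rewrite invr_gt0 ltr0n.
move=> N V col VN exc cov sa.
have [N1|N1] := leqP N 1.
  exists set0; split; last by rewrite cards0; apply: powR_ln_le; rewrite ?exp0n.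
  by apply: small_monochromatic; rewrite ?cards0.
have [N2|N2] := leqP N 2.
  have /card_gt0P[x _] : (0 < #|V|)%N by rewrite VN ltnW.
  exists [set x]; split; last by rewrite cards1; apply: powR_ln_le; rewrite ?exp1n.
  by apply: small_monochromatic; rewrite ?cards1.
have [Nbig|Nsmall] := leqP (2 ^ (2 ^ e.+1)) N; last first.
  have [||C [mC C2]] := monochromatic_pair hr hp cov; rewrite ?VN //.
  exists C; split => //; rewrite C2; apply: powR_ln_le => //.
  by apply: leq_trans (ltnW Nsmall) _; rewrite !leq_exp2l // /E; lia.
have ex : exists n, (2 ^ (n ^ e.+1) <= N)%N by exists 2.
have ub n : (2 ^ (n ^ e.+1) <= N)%N -> (n <= N)%N.
  apply: leq_trans; apply: leq_trans (ltnW (ltn_expl _ (ltnSn 1))).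
  by case: n => // n; rewrite -[leqLHS]expn1 leq_pexp2l.
case: (ex_maxnP ex ub) => n nN nmax.
have n2 : (1 < n)%N by apply: nmax.
have [|C [mC Cn]] := He R V col n n2 _ cov sa.
  by rewrite VN; apply: leq_trans nN; rewrite leq_exp2l // leq_exp2l.
exists C; split => //; rewrite Cn; apply: powR_ln_le => //.
have : (N < 2 ^ (n.+1 ^ e.+1))%N.
  by rewrite ltnNge; apply/negP => /nmax; rewrite ltnn.
move=> /ltnW/leq_trans; apply; rewrite leq_exp2l // /E expnM leq_exp2r //.
by rewrite -mulnn; nia.
Qed.
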